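(* Let $\mathcal R$ denote the set of partitions in which any two parts differ by at least 2. For $\tilde\pi\in\mathcal R$ let $\omega_3(\tilde\pi)=2^r$, where $r$ is the number of odd chains $\chi$ of $\tilde\pi$ with $\lambda(\chi)>1$. Let $A_{6,2}(n)$ denote the number of partitions of $n$ into parts $\not\equiv 0,\pm2\pmod 6$. Then, for every $n\ge 0$, $$A_{6,2}(n)=\sum_{\tilde\pi\in\mathcal R,\ \sigma(\tilde\pi)=n}\omega_3(\tilde\pi).$$
   Context: For a partition $\pi$, $\sigma(\pi)$ denotes the sum of its parts. In a partition whose parts pairwise differ by at least 2, a chain $\chi$ is a maximal block of parts in which consecutive parts differ by exactly 2; such a partition decomposes uniquely into chains, and all parts of a chain have the same parity. A chain is odd if its parts are odd. $\lambda(\chi)$ denotes the least part of the chain $\chi$. *)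

(* Defs.v *)
From HB Require Import structures.
From mathcomp Require Import all_boot.

Set Implicit Arguments.
Unset Strict Implicit.
Unset Printing Implicit Defensive.

(** A partition of [n] is the list of its parts in weakly decreasing order. *)
Definition is_partition (n : nat) (s : seq nat) : bool :=
  [&& sorted geq s, 0 \notin s & sumn s == n].

Record partition_of (n : nat) : predArgType := Partition {
  parts :> seq nat;
  _ : is_partition n parts
}.

HB.instance Definition _ n := [isSub for @parts n].
HB.instance Definition _ n := [Countable of partition_of n by <:].

Lemma size_le_sumn (s : seq nat) : 0 \notin s -> size s <= sumn s.
Proof.
elim: s => //= x s IHs; rewrite inE negb_or eq_sym -lt0n => /andP[x_gt0 /IHs].
by rewrite -add1n; apply: leq_add.
Qed.

Lemma mem_le_sumn (s : seq nat) x : x \in s -> x <= sumn s.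
Proof.
elim: s => //= y s IHs; rewrite inE => /orP[/eqP-> | /IHs le_xs].
  exact: leq_addr.
exact: leq_trans le_xs (leq_addl _ _).
Qed.

Section PartitionFinite.
Variable n : nat.

Definition partition_code (p : partition_of n) : {bseq n of 'I_n.+1} :=
  insub_bseq n (map inord p).

Definition partition_decode (b : {bseq n of 'I_n.+1}) :
  option (partition_of n) := insub (map val b).

Lemma partition_codeK : pcancel partition_code partition_decode.
Proof.
case=> s ps; have /and3P[_ s0 /eqP sn] := ps.
have eq_s : map val (map (@inord n) s) = s.
  rewrite -map_comp -[RHS]map_id; apply/eq_in_map => x /mem_le_sumn.
  by rewrite sn => le_xn /=; rewrite inordK.
rewrite /partition_decode /partition_code /= insubdK; last first.
  by rewrite /= -topredE /= size_map -sn size_le_sumn.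
by rewrite eq_s insubT.
Qed.

HB.instance Definition _ := isFinite.Build (partition_of n)
  (pcan_enumP partition_codeK).
End PartitionFinite.

(** [A k a n] counts the partitions of [n] into parts not congruent to
    0, [a] or [-a] modulo [k]. *)
Definition A (k a n : nat) : nat :=
  #|[set p : partition_of n |
      all (fun m => [&& m != 0 %[mod k], m != a %[mod k]
                      & m + a != 0 %[mod k]]) p]|.

Definition calR (s : seq nat) : bool := pairwise (fun x y => y + 2 <= x) s.

Definition differ_by_2 (x y : nat) : bool := x == y + 2.

(** Chains are listed from the largest parts to the smallest; see [chainsP]. *)
Fixpoint chains (s : seq nat) : seq (seq nat) :=
  if s is x :: s' then
    if chains s' is (y :: c) :: cs then
      if differ_by_2 x y then (x :: y :: c) :: cs
      else [:: x] :: (y :: c) :: cs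
    else [:: [:: x]]
  else [::].

(** [cs] splits [s] into nonempty blocks with consecutive parts differing by
    exactly 2, and no two adjacent blocks can be merged. *)
Definition chain_decomposition (s : seq nat) (cs : seq (seq nat)) : bool :=
  [&& flatten cs == s,
      all (fun c => (c != [::]) && sorted differ_by_2 c) cs
    & sorted (fun c d => ~~ differ_by_2 (last 0 c) (head 0 d)) cs].

Lemma chainsP s cs : reflect (cs = chains s) (chain_decomposition s cs).
Proof.
apply: (iffP idP) => [|->]; last first.
  elim: s => //= x s; case: (chains s) => [|[|y c] cs'].
  - by rewrite /chain_decomposition /= eqseq_cons eqxx /= !andbT => ->.
  - by rewrite /chain_decomposition /= !andbF.
  rewrite /chain_decomposition /= => /and3P[/eqP <- /andP[c2 cs2] cs3].
  case: ifP => xy /=; first by rewrite eqxx c2 cs2 xy; case: (cs') cs3.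
  by rewrite eqxx c2 cs2 xy.
elim: s cs => [|x s IHs] [|[|y c] cs] //; rewrite /chain_decomposition /=.
- by rewrite andbF.
- by rewrite andbF.
- move=> /and3P[/eqP[-> def_s] /andP[c2 cs2] cs3].
  case: c => [|z c] in def_s c2 cs3 *.
    rewrite -(IHs cs); last first.
      rewrite /chain_decomposition -def_s eqxx cs2 /=.
      by case: (cs) cs3 => //= ? ? /andP[].
    by case: cs cs2 cs3 {def_s} => [|[|z c] cs] //= _ /andP[/negbTE->].
  rewrite -(IHs ((z :: c) :: cs)); last first.
    rewrite /chain_decomposition -def_s /= eqxx cs2 /=.
    by move: c2 => /= /andP[_ ->]; case: (cs) cs3.
  by move: c2 => /= /andP[->].
Qed.

Definition odd_chain (c : seq nat) : bool := all odd c.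

(** The least part of a chain, whose parts are listed in decreasing order. *)
Definition lambda (c : seq nat) : nat := last 0 c.

Definition omega3 (s : seq nat) : nat :=
  2 ^ count (fun c => odd_chain c && (1 < lambda c)) (chains s).

(* Main.v *)
Require Import Defs.
From mathcomp Require Import all_boot.
From mathcomp Require Import ssralg ssrnum ssrint poly polydiv qpoly ring zify.

(** A part avoids the residues 0, 2 and -2 modulo 6 exactly when it is odd, so
    the claim is that the partitions in [calR], counted with weight [omega3], have
    the generating function of the partitions into odd parts. By Euler that is
    also the product of the factors 1 + x^k, and this product is the bridge.

    Weights to a product in z.  Let z mark the number m of parts. Subtracting
    the staircase 2(m-1), ..., 2, 0 from a partition in [calR] leaves an
    arbitrary partition with m positive parts; its chains become the blocks of
    equal parts, and a chain is odd with least part greater than 1 exactly when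
    the common value of its block is odd and greater than 1. A value v thus
    contributes 1/(1 - z x^v), or (1 + z x^v)/(1 - z x^v) if it is doubled when
    used. Bounding the parts makes this an identity between polynomials which
    follows from a recursion on the largest part ([coef_gap2_gf]). Adding the
    staircase back multiplies the coefficient of z^m by x^(m(m-1)); write L for
    this linear operation at z = 1 ([add_gaps]).

    Evaluating L.  Let g(s) be L applied to
      prod_(v > s) 1/(1 - z x^v) * prod_(k > s) (1 + z x^(2k+1)),
    so that g(0) is the weighted count. Peeling off one factor of each product
    gives a difference with a factor z, and L (z f(z)) = L (f(x^2 z)), where
    z -> x^2 z raises s by 2 in the first product and by 1 in the second. The
    outcome is
      g(s) = g(s+1) + x^(s+1) (1 + x^(s+2)) g(s+2)   ([block_gf_rec]),
    a recursion that prod_(k > s) (1 + x^k) satisfies too. It expresses that a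
    partition into distinct parts greater than s either omits s+1, or starts
    with s+1 alone, or with the pair s+1, s+2.

    Only the coefficient of x^n matters, so the computation takes place in a
    commutative ring where x^(n+1) = 0: there all products are finite and
    1/(1 - t) is a finite geometric sum. The coefficient is finally read off in
    the ring of integer polynomials modulo X^(n+1). *)

Set Implicit Arguments.
Unset Strict Implicit.
Unset Printing Implicit Defensive.

Import GRing.Theory.

(** * Enumerating the partitions with differences at least 2 *)

(** The partitions in [calR] with all parts at most [k]. For [k = 1] the
    truncation [0.-1 = 0] is harmless: no part fits below either way. *)
Fixpoint gap2_upto (k : nat) : seq (seq nat) :=
  if k is k'.+1 then gap2_upto k' ++ map (cons k) (gap2_upto k'.-1)
  else [:: [::]].

Lemma calR_cons x s : calR (x :: s) = all (fun y => y + 2 <= x) s && calR s.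
Proof. by []. Qed.

Lemma mem_map_cons (T : eqType) (x y : T) s (L : seq (seq T)) :
  (y :: s \in map (cons x) L) = (y == x) && (s \in L).
Proof.
apply/mapP/andP => [[t tL [-> ->]]|[/eqP-> sL]]; first by rewrite eqxx.
by exists s.
Qed.

Lemma mem_gap2_upto k s :
  (s \in gap2_upto k) = [&& calR s, 0 \notin s & all (leq^~ k) s].
Proof.
have [r] := ubnP k; elim: r k s => // r IHr [|k] s.
  by case: s => // [[|y]] s; rewrite /calR !(inE, andbF).
move=> /= lt_kr; rewrite mem_cat IHr //; case: s => [//|y s].
rewrite mem_map_cons IHr; last by lia.
rewrite calR_cons inE negb_or [all _ (y :: s)]/= [all (leq^~ k.+1) (y :: s)]/=.
case: (calR s); rewrite ?andbF //=.
have [s0|s0] := boolP (0 \in s); rewrite ?andbF //= !andbT.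
have s_gt0 t : t \in s -> 0 < t.
  by move=> ts; rewrite lt0n; apply: contraNneq s0 => <-.
case: (y =P k.+1) => [->|neq_y] /=.
  rewrite ltnn leqnn !andbF /=.
  apply/allP/andP => [le_sk|[/allP le_s _] t /[dup] /le_s + /s_gt0].
    by split; apply/allP=> t /[dup] /le_sk + /s_gt0; lia.
  by lia.
rewrite orbF; apply/and4P/and4P => -[/[dup] lt_sy /allP ltsy y0 le_yk le_sk].
  split=> //; first by lia.
  by apply/allP => t /ltsy; lia.
have {}le_yk : y <= k by lia.
by split=> //; apply/allP => t /ltsy; lia.
Qed.

Lemma gap2_upto_uniq k : uniq (gap2_upto k).
Proof.
have [r] := ubnP k; elim: r k => // r IHr [|k] //= lt_kr.
rewrite cat_uniq IHr // map_inj_uniq => [|s t [//]].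
rewrite IHr ?andbT; last by lia.
apply/hasPn => _ /mapP[s _ ->]; rewrite mem_gap2_upto /= ltnn.
by apply/negP; lia.
Qed.

(** * The weight of a partition with a new largest part *)

Lemma chains_cons x s :
  chains (x :: s) =
    if chains s is (y :: c) :: cs then
      if differ_by_2 x y then (x :: y :: c) :: cs
      else [:: x] :: (y :: c) :: cs
    else [:: [:: x]].
Proof. by []. Qed.

Lemma head_chains y s : exists c cs, chains (y :: s) = (y :: c) :: cs.
Proof.
rewrite chains_cons; case: (chains s) => [|[|z c] cs].
- by exists [::], [::].
- by exists [::], [::].
by case: ifP => _; [exists (z :: c), cs|exists [::], ((z :: c) :: cs)].
Qed.

(** A chain keeps its least part and its parity when it grows at the top, so
    the weight changes only when the new part starts a chain of its own. *)
Lemma omega3_cons x s :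
  omega3 (x :: s) =
    if (s != [::]) && (x == head 0 s + 2) then omega3 s
    else 2 ^ (odd x && (1 < x)) * omega3 s.
Proof.
rewrite /omega3; case: s => [|y s].
  by rewrite /= /odd_chain /lambda /= andbT addn0 muln1.
have [c [cs def_c]] := head_chains y s.
rewrite chains_cons def_c /= /differ_by_2; case: eqP => [->|_] /=.
  congr (2 ^ (_ + _)); rewrite /odd_chain /lambda /= oddD addbF.
  by case: (odd y).
by rewrite -expnD /odd_chain /lambda /= andbT.
Qed.

(** * Enumerating the partitions into odd parts *)

Section OddLists.
Variable n : nat.

(** Decreasing lists of odd parts below [N.*2], each repeated at most [n]
    times; the recursion chooses the multiplicity of the largest part, which
    turns sums over these lists into products. *)
Fixpoint odd_lists N : seq (seq nat) :=
  if N is N'.+1 then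
    [seq nseq e N'.*2.+1 ++ s | e <- iota 0 n.+1, s <- odd_lists N']
  else [:: [::]].

Lemma odd_listsS N : odd_lists N.+1 =
  [seq nseq e N.*2.+1 ++ s | e <- iota 0 n.+1, s <- odd_lists N].
Proof. by []. Qed.

Lemma sorted_geq_cons x s :
  sorted geq (x :: s) = all (fun y => y <= x) s && sorted geq s.
Proof. by rewrite /= path_sortedE //; apply: rev_trans leq_trans. Qed.

Lemma odd_listsP N s : s \in odd_lists N ->
  [/\ sorted geq s, all odd s & all (fun y => y < N.*2) s].
Proof.
elim: N s => [|N IHN] s; first by rewrite inE => /eqP->.
case/allpairsP=> -[e t] /= [_ /IHN[sorted_t odd_t lt_t] ->].
have le_t : all (fun y => y <= N.*2.+1) t.
  by apply: sub_all lt_t => y /ltnW /leqW.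
split.
- elim: e => //= e IHe; rewrite -/(sorted geq (_ :: _)) sorted_geq_cons IHe.
  by rewrite andbT all_cat le_t andbT all_nseq leqnn orbT.
- by rewrite all_cat odd_t all_nseq /= odd_double orbT.
rewrite all_cat all_nseq doubleS ltnSn orbT /=.
by apply: sub_all lt_t => y; lia.
Qed.

Lemma sorted_nseq_cat a s : sorted geq s -> all (fun y => y <= a) s ->
  s = nseq (count_mem a s) a ++ filter (fun y => y < a) s.
Proof.
elim: s => // x s IHs; rewrite sorted_geq_cons.
move=> /andP[le_sx sorted_s] /= /andP[le_xa le_sa].
have [eq_xa|neq_xa] := eqVneq x a.
  by rewrite eq_xa ltnn /= -IHs.
have lt_xa : x < a by rewrite ltn_neqAle neq_xa.
have lt_s : all (fun y => y < a) s.
  by apply: sub_all le_sx => y /leq_ltn_trans->.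
rewrite lt_xa (all_filterP lt_s) (count_memPn _) //.
by apply/negP => /(allP lt_s); rewrite ltnn.
Qed.

Lemma mem_odd_lists N s : size s <= n ->
  sorted geq s -> all odd s -> all (fun y => y < N.*2) s -> s \in odd_lists N.
Proof.
elim: N s => [|N IHN] s; first by case: s.
move=> le_sn sorted_s odd_s; rewrite doubleS => lt_s.
rewrite [s](sorted_nseq_cat (a := N.*2.+1)) //.
apply: allpairs_f.
  by rewrite mem_iota /= ltnS (leq_trans _ le_sn) // count_size.
apply: IHN; first by rewrite (leq_trans _ le_sn) // size_filter count_size.
- by rewrite sorted_filter //; apply: rev_trans leq_trans.
- by apply/allP => y; rewrite mem_filter => /andP[_ /(allP odd_s)].
apply/allP => y; rewrite mem_filter => /andP[lt_y /(allP odd_s) odd_y].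
by lia.
Qed.

Lemma odd_lists_uniq N : uniq (odd_lists N).
Proof.
elim: N => // N IHN; rewrite odd_listsS.
apply: allpairs_uniq; rewrite ?iota_uniq //.
move=> u v uL vL.
have /allpairsP/= [[e s] [_ /odd_listsP[_ _ lt_s] ->]] := uL.
have /allpairsP/= [[f t] [_ /odd_listsP[_ _ lt_t] ->]] := vL.
move=> /= eq_st.
have count0 w : all (fun y => y < N.*2) w -> count_mem N.*2.+1 w = 0.
  by move/allP=> lt_w; apply/count_memPn/negP => /lt_w; lia.
have := congr1 (count_mem N.*2.+1) eq_st.
rewrite !count_cat !count_nseq /= eqxx !mul1n !count0 // !addn0 => eq_ef.
by move: eq_st; rewrite eq_ef => /eqP; rewrite eqseq_cat // eqxx /= => /eqP->.
Qed.

End OddLists.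

Section Series.
Local Open Scope ring_scope.

(** * Euler's theorem as a product identity *)

Lemma geometric_inv (S : comNzRingType) (t : S) n :
  t ^+ n.+1 = 0 -> (1 - t) * (\sum_(e < n.+1) t ^+ e) = 1.
Proof. by move=> tn; rewrite -[1 - t]opprB mulNr -subrX1 tn sub0r opprK. Qed.

(** A form of Euler's theorem free of denominators: going from [n] to [n.+1]
    appends 1 - x^(2n+1) on the right
    and replaces 1 - x^(n+1) by
    (1 - x^(n+1)) (1 + x^(n+1)) = 1 - x^(2n+2). *)
Lemma euler_product (S : comNzRingType) (x : S) n :
  (\prod_(0 <= k < n) (1 + x ^+ k.+1)) *
    (\prod_(0 <= k < n) (1 - x ^+ k.*2.+1))
  = \prod_(n <= k < n.*2) (1 - x ^+ k.+1).
Proof.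
elim: n => [|n IHn]; first by rewrite !big_geq ?mulr1.
rewrite [X in X * _]big_nat_recr // [X in _ * X]big_nat_recr //=.
rewrite mulrACA IHn doubleS.
rewrite [RHS]big_nat_recr /=; last by rewrite ltnS -addnn leq_addr.
have -> : \prod_(n <= k < n.*2) (1 - x ^+ k.+1) *
    ((1 + x ^+ n.+1) * (1 - x ^+ n.*2.+1))
  = (1 + x ^+ n.+1) * \prod_(n <= k < n.*2.+1) (1 - x ^+ k.+1).
  have le_n2n : (n <= n.*2)%N by rewrite -addnn leq_addr.
  by rewrite [in RHS]big_nat_recr //=; ring.
rewrite big_ltn; last by rewrite ltnS -addnn leq_addr.
rewrite mulrA [RHS]mulrC; congr (_ * _).
have -> : n.*2.+2 = (n.+1 + n.+1)%N by rewrite -addnn addnS addSn.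
by rewrite exprD; ring.
Qed.

Lemma prod_nat_stable (S : comNzRingType) (f : nat -> S) n s N :
  (n <= N)%N -> (forall i, (n <= i)%N -> f i = 1) ->
  \prod_(s <= i < N) f i = \prod_(s <= i < n) f i.
Proof.
move=> leNn f1; have [les|lts] := leqP s n; last first.
  rewrite [RHS]big_geq ?(ltnW lts) // big_nat big1 // => i /andP[si _].
  by rewrite f1 // (leq_trans (ltnW lts)).
rewrite (big_cat_nat les leNn) /= [X in _ * X]big_nat [X in _ * X]big1 ?mulr1 //.
by move=> i /andP[/f1].
Qed.

Section Nilpotent.
Variables (K : comNzRingType) (n : nat) (x : K).
Hypothesis xn0 : x ^+ n.+1 = 0.

Lemma expr_eq0_gt k : (n < k)%N -> x ^+ k = 0.
Proof. by move=> /subnKC <-; rewrite exprD xn0 mul0r. Qed.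

Lemma prod_distinct_odd :
  (\prod_(0 <= k < n) (1 + x ^+ k.+1)) *
    (\prod_(0 <= k < n) (1 - x ^+ k.*2.+1)) = 1.
Proof.
rewrite euler_product big_nat big1 // => k /andP[nk _].
by rewrite expr_eq0_gt ?subr0.
Qed.

Lemma sum_odd_lists N :
  \sum_(s <- odd_lists n N) x ^+ sumn s =
  \prod_(0 <= k < N) \sum_(e < n.+1) (x ^+ k.*2.+1) ^+ e.
Proof.
elim: N => [|N IHN]; first by rewrite big_seq1 big_geq.
rewrite odd_listsS big_allpairs_dep big_nat_recr //= mulrC -IHN mulr_suml.
rewrite -/(iota 0 n.+1) -[n.+1 in LHS]subn0 -/(index_iota 0 n.+1) big_mkord.
apply: eq_bigr => e _; rewrite mulr_sumr; apply: eq_bigr => s _.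
by rewrite sumn_cat sumn_nseq exprD exprM.
Qed.

Lemma sum_odd_lists_inv N :
  (\sum_(s <- odd_lists n N) x ^+ sumn s) *
    (\prod_(0 <= k < N) (1 - x ^+ k.*2.+1)) = 1.
Proof.
rewrite sum_odd_lists -big_split big1 // => k _ /=.
by rewrite mulrC geometric_inv // -exprM expr_eq0_gt // leq_pmull.
Qed.

(** * Removing the staircase: a product formula for the weighted series *)

(** Polynomials over [K] are polynomials in the variable z of the header. *)
Definition zx v : {poly K} := x ^+ v *: 'X.

Definition geo v : {poly K} := \sum_(e < n.+1) zx v ^+ e.

Lemma zx_eq0_gt v : (n < v)%N -> zx v = 0.
Proof. by move=> nv; rewrite /zx expr_eq0_gt ?scale0r. Qed.

(** For [v = 0] this fails, as [zx 0] is not nilpotent. This is why the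
    staircase starts at 0 and the remaining parts stay positive. *)
Lemma geoE v : (0 < v)%N -> (1 - zx v) * geo v = 1.
Proof.
move=> v0; apply: geometric_inv.
by rewrite /zx exprZn -exprM expr_eq0_gt ?scale0r // mulnC leq_pmulr.
Qed.

Lemma geo_gt v : (n < v)%N -> geo v = 1.
Proof.
move=> nv; rewrite -[LHS]mul1r -[1 in LHS]subr0 -(zx_eq0_gt nv) geoE //.
exact: leq_ltn_trans nv.
Qed.

Definition doubling v := odd v && (1 < v)%N.

(** The series of all partitions into positive parts at most [M], with weight
    2 for each doubling value that occurs: 1 + 2 (t + t^2 + ...) equals
    (1 + t) / (1 - t). *)
Definition block_weight_gf M : {poly K} :=
  \prod_(0 <= v < M) ((1 + zx v.+1 *+ doubling v.+1) * geo v.+1).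

Lemma block_weight_gf0 : block_weight_gf 0 = 1.
Proof. by rewrite /block_weight_gf big_geq. Qed.

Lemma block_weight_gf_rec M :
  block_weight_gf M.+1 = block_weight_gf M +
    zx M.+1 * (block_weight_gf M.+1 + block_weight_gf M *+ doubling M.+1).
Proof.
have E : block_weight_gf M.+1 * (1 - zx M.+1) =
    block_weight_gf M * (1 + zx M.+1 *+ doubling M.+1).
  rewrite /block_weight_gf big_nat_recr //= -!mulrA; congr (_ * _).
  by rewrite [geo _ * _]mulrC geoE // mulr1.
rewrite -[LHS](subrK (block_weight_gf M.+1 * zx M.+1)).
rewrite -[X in X - _]mulr1 -mulrBr E.
by case: doubling; ring.
Qed.

Lemma coef_zxM v p m : (zx v * p)`_m.+1 = x ^+ v * p`_m.
Proof. by rewrite -scalerAl coefZ coefXM. Qed.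

Lemma coef_zxM0 v p : (zx v * p)`_0 = 0.
Proof. by rewrite -scalerAl coefZ coefXM mulr0. Qed.

Lemma coef_block_weight_gf_rec M m :
  (block_weight_gf M.+1)`_m.+1 =
  (block_weight_gf M)`_m.+1 +
  x ^+ M.+1 *
    ((block_weight_gf M.+1)`_m + (block_weight_gf M)`_m *+ doubling M.+1).
Proof. by rewrite [in LHS]block_weight_gf_rec coefD coef_zxM coefD coefMn. Qed.

Lemma coef0_block_weight_gf M : (block_weight_gf M)`_0 = 1.
Proof.
elim: M => [|M IHM]; first by rewrite block_weight_gf0 coef1.
by rewrite block_weight_gf_rec coefD coef_zxM0 addr0.
Qed.

Definition weight (s : seq nat) : K := (omega3 s)%:R * x ^+ sumn s.

Definition gap2_gf k : {poly K} :=
  \sum_(s <- gap2_upto k) weight s *: 'X^(size s).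

Lemma gap2_gf0 : gap2_gf 0 = 1.
Proof. by rewrite /gap2_gf big_seq1 /weight /= mulr1 expr0 scale1r. Qed.

Lemma sum_weight_cons k (L : seq (seq nat)) c :
  (forall s, s \in L -> omega3 (k :: s) = c * omega3 s)%N ->
  \sum_(s <- map (cons k) L) weight s *: 'X^(size s) =
  c%:R *: (zx k * \sum_(s <- L) weight s *: 'X^(size s)).
Proof.
move=> Lc; rewrite big_map mulr_sumr scaler_sumr !big_seq.
apply: eq_bigr => s sL.
rewrite /weight Lc // /zx /= exprS exprD natrM -!scalerAl -scalerAr !scalerA.
by congr (_ *: _); ring.
Qed.

(** A part [k.+1] may be followed by anything up to [k.-1]. Followed by
    [k.-1] itself it extends a chain; otherwise the rest lies in
    [gap2_upto k.-2] and, if [k.+1] is doubling, counts a second time. *)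
Lemma gap2_gf_rec k :
  gap2_gf k.+1 =
  gap2_gf k + zx k.+1 * (gap2_gf k.-1 + gap2_gf k.-2 *+ doubling k.+1).
Proof.
rewrite {1}/gap2_gf /= big_cat /=; congr (_ + _).
case: k => [|[|k]].
- rewrite (@sum_weight_cons _ _ 1) ?scale1r ?addr0 // => s.
  by rewrite inE => /eqP->.
- rewrite (@sum_weight_cons _ _ 1) ?scale1r ?addr0 // => s.
  by rewrite inE => /eqP->.
rewrite /= map_cat big_cat /=.
rewrite (@sum_weight_cons _ _ (2 ^ doubling k.+3)%N); last first.
  move=> s; rewrite mem_gap2_upto omega3_cons => /and3P[_ _].
  case: s => [|y s] //= /andP[leyk _].
  by case: eqP => // -[E]; lia.
rewrite (@sum_weight_cons _ _ 1); last first.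
  by move=> _ /mapP[s _ ->]; rewrite mul1n [LHS]omega3_cons /= addn2 eqxx.
rewrite -/(gap2_gf k) [in gap2_gf k.+1]/gap2_gf /= big_cat /=.
rewrite -/(gap2_gf k) scale1r.
case: (doubling _); rewrite ?scale1r ?addr0 -?mulrDr //=.
by rewrite expn1 scaler_nat mulr2n; ring.
Qed.

Lemma coef0_gap2_gf k : (gap2_gf k)`_0 = 1.
Proof.
elim: k => [|k IHk]; first by rewrite gap2_gf0 coef1.
by rewrite gap2_gf_rec coefD coef_zxM0 addr0.
Qed.

(** With [m] parts at most [k], the staircase has sum [m * m.-1] and takes
    2(m-1) from the largest part; both sides obey the same recursion. If
    [k.+2 < m.*2] the truncated bound is 0 and the coefficient vanishes, as it
    should. *)
Lemma coef_gap2_gf k m :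
  (gap2_gf k)`_m = x ^+ (m * m.-1) * (block_weight_gf (k.+2 - m.*2))`_m.
Proof.
have [r] := ubnP k; elim: r k m => // r IHr k [|m] ltkr.
  by rewrite coef0_gap2_gf coef0_block_weight_gf mulr1.
case: k ltkr => [|k] ltkr.
  by rewrite gap2_gf0 block_weight_gf0 !coef1 mulr0.
rewrite gap2_gf_rec coefD coef_zxM coefD coefMn !IHr; try lia.
have -> : (k.+3 - m.+1.*2 = k.+1 - m.*2)%N by lia.
have -> : (k.+2 - m.+1.*2 = k - m.*2)%N by lia.
case: m => [|m].
  rewrite double0 !subn0 !coef0_block_weight_gf coef_block_weight_gf_rec.
  by rewrite !coef0_block_weight_gf /=; ring.
have [le_km|lt_mk] := ltnP m.+1.*2 k.+1; last first.
  do ![rewrite (_ : _ - _ = 0)%N; last by lia].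
  by rewrite !block_weight_gf0 !coef1 /= !(mulr0n, mul0rn, mulr0, addr0).
have [M def_k] : {M | k = M + m.+1.*2}%N by exists (k - m.+1.*2)%N; lia.
have -> : (k.-1.+2 - m.+1.*2 = M.+1)%N by lia.
have -> : (k.-2.+2 - m.+1.*2 = M)%N by lia.
have -> : (k.+1 - m.+1.*2 = M.+1)%N by lia.
have -> : (k - m.+1.*2 = M)%N by lia.
rewrite -mulrnAr.
(* Only M = 0 could tell the two conditions apart, and there the coefficient
   is 0. *)
have -> : (block_weight_gf M)`_m.+1 *+ doubling k.+1 =
    (block_weight_gf M)`_m.+1 *+ doubling M.+1.
  case: M def_k => [|M] ->.
    by rewrite block_weight_gf0 coef1 /= mulr0n !mul0rn.
  by rewrite /doubling -addSn oddD odd_double addbF.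
rewrite [in RHS]coef_block_weight_gf_rec [RHS]mulrDr.
rewrite [x ^+ (m.+2 * _) * (_ * _)]mulrA -exprD.
have -> : (m.+2 * m.+2.-1 + M.+1 = k.+1 + m.+1 * m.+1.-1)%N.
  by rewrite def_k /=; nia.
by rewrite exprD; case: doubling; ring.
Qed.

(** * Restoring the staircase *)

(** Since m(m-1) > n for m >= n+2, the bound [n.+2] loses nothing; with
    [n.+1] instead [add_gapsX] would fail for [n = 0]. *)
Definition add_gaps (p : {poly K}) : K :=
  \sum_(m < n.+2) p`_m * x ^+ (m * m.-1).

Lemma add_gapsD p q : add_gaps (p + q) = add_gaps p + add_gaps q.
Proof. by rewrite -big_split; apply: eq_bigr => m _; rewrite coefD mulrDl. Qed.

Lemma add_gapsZ c p : add_gaps (c *: p) = c * add_gaps p.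
Proof. by rewrite mulr_sumr; apply: eq_bigr => m _; rewrite coefZ mulrA. Qed.

Lemma add_gaps1 : add_gaps 1 = 1.
Proof.
rewrite /add_gaps big_ord_recl coef1 mul1r big1 ?addr0 // => m _.
by rewrite coef1 mul0r.
Qed.

Definition qscale (p : {poly K}) : {poly K} := p \Po (x ^+ 2 *: 'X).

Lemma coef_qscale p m : (qscale p)`_m = x ^+ m.*2 * p`_m.
Proof.
rewrite /qscale comp_polyE coef_sum.
under eq_bigr => i _ do rewrite exprZn -exprM coefZ coefZ coefXn.
have [lt_mp|le_pm] := ltnP m (size p).
  rewrite (bigD1 (Ordinal lt_mp)) //= eqxx mulr1 big1 ?addr0 => [|i].
    by rewrite mulrC mul2n.
  by rewrite -val_eqE /= eq_sym => /negbTE->; rewrite !mulr0.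
rewrite nth_default // mulr0 big1 // => i _.
by rewrite gtn_eqF ?mulr0 // (leq_trans _ le_pm).
Qed.

(** The rule (m+1) m = m (m-1) + 2m: adding a part lengthens the staircase by
    2 below each of the other parts. *)
Lemma add_gapsX p : add_gaps ('X * p) = add_gaps (qscale p).
Proof.
rewrite /add_gaps big_ord_recl coefXM mul0r add0r [RHS]big_ord_recr /=.
rewrite [(qscale p)`_n.+1]coef_qscale expr_eq0_gt; last by lia.
rewrite !mul0r addr0; apply: eq_bigr => m _.
rewrite /bump coefXM coef_qscale /= mulrAC -exprD mulrC; congr (x ^+ _ * _).
by case: (nat_of_ord m) => //= k; nia.
Qed.

Lemma qscale_zx v : qscale (zx v) = zx v.+2.
Proof. by rewrite /qscale /zx linearZ /= comp_polyX scalerA -exprD addn2. Qed.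

Lemma qscale_geo v : qscale (geo v) = geo v.+2.
Proof.
rewrite /qscale rmorph_sum; apply: eq_bigr => e _.
by rewrite rmorphXn /= -/(qscale _) qscale_zx.
Qed.

Definition geo_tail s : {poly K} := \prod_(s <= v < n) geo v.+1.
Definition odd_tail s : {poly K} := \prod_(s <= k < n) (1 + zx k.*2.+3).

Lemma qscale_geo_tail s : qscale (geo_tail s) = geo_tail s.+2.
Proof.
have tail_ext : \prod_(s.+2 <= v < n.+2) geo v.+1 = geo_tail s.+2.
  by apply: prod_nat_stable => [|i ni]; [lia | exact: geo_gt].
rewrite -tail_ext /geo_tail !big_add1 /= /qscale rmorph_prod.
by apply: eq_bigr => v _; exact: qscale_geo.
Qed.

Lemma qscale_odd_tail s : qscale (odd_tail s) = odd_tail s.+1.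
Proof.
have tail_ext : \prod_(s.+1 <= k < n.+1) (1 + zx k.*2.+3) = odd_tail s.+1.
  apply: prod_nat_stable => // i ni.
  by rewrite zx_eq0_gt ?addr0 //; lia.
rewrite -tail_ext /odd_tail !big_add1 /= /qscale rmorph_prod.
apply: eq_bigr => v _.
by rewrite rmorphD rmorph1 /= -/(qscale _) qscale_zx.
Qed.

Lemma geo_tail_rec s : (1 - zx s.+1) * geo_tail s = geo_tail s.+1.
Proof.
rewrite /geo_tail; have [lt_sn|le_ns] := ltnP s n.
  by rewrite big_ltn // mulrA geoE // mul1r.
by rewrite !big_geq ?(leqW le_ns) // zx_eq0_gt // subr0 mulr1.
Qed.

Lemma odd_tail_rec s : odd_tail s = (1 + zx s.*2.+3) * odd_tail s.+1.
Proof.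
rewrite /odd_tail; have [lt_sn|le_ns] := ltnP s n; first by rewrite big_ltn.
rewrite !big_geq ?(leqW le_ns) // mulr1 zx_eq0_gt ?addr0 //.
by rewrite ltnS (leq_trans le_ns) //; lia.
Qed.

(** The series of the partitions into distinct parts greater than [s]. With
    the parts grouped greedily from below into single parts and pairs of
    consecutive integers, the term for [m] in [add_gaps] collects those with
    [m] groups. *)
Definition block_gf s := add_gaps (geo_tail s * odd_tail s).

(** From (1 + z x^(2s+3)) - (1 - z x^(s+1)) = z x^(s+1) (1 + x^(s+2)). *)
Lemma block_gf_rec s :
  block_gf s =
  block_gf s.+1 + x ^+ s.+1 * (1 + x ^+ s.+2) * block_gf s.+2.
Proof.
have -> : block_gf s.+2 = add_gaps ('X * (geo_tail s * odd_tail s.+1)).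
  rewrite add_gapsX /qscale rmorphM /= -!/(qscale _).
  by rewrite qscale_geo_tail qscale_odd_tail.
rewrite -add_gapsZ -add_gapsD; congr add_gaps.
rewrite -geo_tail_rec odd_tail_rec /zx.
have -> : s.*2.+3 = (s.+1 + s.+2)%N by lia.
rewrite exprD [x ^+ s.+2]exprS -!mul_polyC !(polyCM, polyCD) polyC1.
by move: (geo_tail s) (odd_tail s.+1) (x ^+ s.+1)%:P => a c y; ring.
Qed.

Lemma block_gf_big s : (n <= s)%N -> block_gf s = 1.
Proof.
move=> le_ns.
by rewrite /block_gf /geo_tail /odd_tail !big_geq // mulr1 add_gaps1.
Qed.

(** Both sides satisfy the recursion of [block_gf_rec], the right-hand one
    because (1 + a)(1 + b) = (1 + b) + a (1 + b). *)
Lemma block_gf_prod s : block_gf s = \prod_(s <= k < n) (1 + x ^+ k.+1).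
Proof.
have [r] := ubnP (n - s); elim: r s => // r IHr s lt_r.
have [lt_sn|le_ns] := ltnP s n; last by rewrite block_gf_big // big_geq.
rewrite block_gf_rec !IHr; try lia.
rewrite [in RHS]big_ltn //; have [lt_s1n|le_ns1] := ltnP s.+1 n.
  by rewrite (big_ltn lt_s1n); ring.
by rewrite !big_geq ?(leqW le_ns1) // [x ^+ s.+2]expr_eq0_gt //; ring.
Qed.

Lemma block_weight_gf_stable M :
  (n <= M)%N -> block_weight_gf M = geo_tail 0 * odd_tail 0.
Proof.
move=> le_nM.
have stable N : (n <= N)%N -> block_weight_gf N = block_weight_gf n.
  move=> leN; apply: prod_nat_stable => // i ni.
  by rewrite geo_gt // zx_eq0_gt // mul0rn addr0 mulr1.
(* An odd number of factors lets the doubling values 3, 5, ... be matched two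
   factors at a time. *)
rewrite stable // -(stable n.*2.+1); last by lia.
rewrite /block_weight_gf big_split /= mulrC; congr (_ * _).
  by apply: prod_nat_stable => [|i ni]; [lia|rewrite geo_gt].
rewrite /odd_tail; elim: (n) => [|k IHk].
  by rewrite big_nat1 big_geq // mulr0n addr0.
rewrite doubleS big_nat_recr // big_nat_recr //= IHk [RHS]big_nat_recr //=.
by rewrite /doubling /= odd_double /= mulr0n addr0 mulr1 mulr1n.
Qed.

(** Partitions with a part above [n] have weight 0. The generous bound [3 * n] ensures that
    [block_weight_gf_stable] applies to every coefficient up to [n.+1]. *)
Lemma sum_weight : \sum_(s <- gap2_upto (3 * n)) weight s =
  \prod_(0 <= k < n) (1 + x ^+ k.+1).
Proof.
rewrite -block_gf_prod /block_gf.
transitivity (\sum_(m < n.+2) (gap2_gf (3 * n))`_m); last first.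
  apply: eq_bigr => m _; rewrite coef_gap2_gf mulrC block_weight_gf_stable //.
  by have := ltn_ord m; lia.
under [RHS]eq_bigr => m _ do rewrite /gap2_gf coef_sum.
rewrite [RHS]exchange_big big_seq [RHS]big_seq; apply: eq_bigr => s.
rewrite mem_gap2_upto => /and3P[_ s0 _].
under [RHS]eq_bigr => m _ do rewrite coefZ coefXn.
have [lt_sn|lt_ns] := ltnP (size s) n.+2.
  rewrite (bigD1 (Ordinal lt_sn)) //= eqxx mulr1 big1 ?addr0 // => m.
  by rewrite -val_eqE /= => /negbTE->; rewrite mulr0.
rewrite big1 => [|m _].
  rewrite /weight expr_eq0_gt ?mulr0 //.
  by rewrite (leq_trans (ltnW lt_ns)) // size_le_sumn.
by rewrite ltn_eqF ?mulr0 // (leq_trans _ lt_ns).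
Qed.

Lemma sum_odd_lists_weight :
  \sum_(s <- odd_lists n n) x ^+ sumn s =
  \sum_(s <- gap2_upto (3 * n)) weight s.
Proof.
rewrite sum_weight -[LHS]mulr1 -[X in _ * X]prod_distinct_odd mulrCA.
by rewrite sum_odd_lists_inv mulr1.
Qed.

End Nilpotent.

(** * Reading off a coefficient *)

Section Truncated.
Variable n : nat.

Definition truncated := {poly %/ ('X^(n.+1) : {poly int})}.
Definition qX : truncated := in_qpoly ('X^(n.+1)) 'X.

Lemma qXE k : qX ^+ k = in_qpoly ('X^(n.+1)) 'X^k.
Proof. by rewrite rmorphXn. Qed.

Lemma mk_monic_XnS : mk_monic ('X^(n.+1) : {poly int}) = 'X^(n.+1).
Proof. by rewrite mk_monic_Xn. Qed.

Lemma qX_nilp : qX ^+ n.+1 = 0.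
Proof.
rewrite qXE; apply/val_inj => /=.
by rewrite mk_monic_XnS Pdiv.RingMonic.rmodpp ?monicXn.
Qed.

Lemma coef_qX k : (qX ^+ k)`_n = (k == n)%:R.
Proof.
have [le_kn|lt_nk] := leqP k n; last first.
  by rewrite (expr_eq0_gt qX_nilp) // coef0 gtn_eqF.
by rewrite qXE in_qpoly_small ?mk_monic_XnS ?size_polyXn // coefXn eq_sym.
Qed.

Lemma coef_sum_qX (T : Type) (L : seq T) (c f : T -> nat) :
  (\sum_(s <- L) (c s)%:R * qX ^+ f s)`_n =
  (\sum_(s <- L | f s == n) c s)%:R.
Proof.
rewrite coefn_sum natr_sum [RHS]big_mkcond; apply: eq_bigr => s _.
rewrite mulr_natl raddfMn /= coefMn coef_qX.
by case: eqP; rewrite ?mul0rn.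
Qed.

Lemma count_odd_lists_omega3 :
  (\sum_(s <- odd_lists n n | sumn s == n) 1 =
   \sum_(s <- gap2_upto (3 * n) | sumn s == n) omega3 s)%N.
Proof.
apply/eqP; rewrite -(Num.Theory.eqr_nat int) -!coef_sum_qX; apply/eqP.
congr (nth _ (polyseq (polyn _)) n).
under eq_bigr => s _ do rewrite mul1r.
exact: sum_odd_lists_weight qX_nilp.
Qed.

End Truncated.
End Series.

Lemma sum_partition_of n (P : pred (seq nat)) (f : seq nat -> nat) L :
    uniq L ->
    (forall s, (s \in L) && (sumn s == n) = is_partition n s && P s) ->
  \sum_(p : partition_of n | P p) f p = \sum_(s <- L | sumn s == n) f s.
Proof.
move=> uniqL memL.
rewrite -[LHS]big_filter -[RHS]big_filter -[LHS](big_map (@parts n) xpredT).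
apply: perm_big; apply: uniq_perm.
- by rewrite map_inj_uniq ?filter_uniq ?index_enum_uniq //; apply: val_inj.
- exact: filter_uniq.
move=> s; rewrite mem_filter [RHS]andbC memL.
apply/mapP/andP => [[p + ->]|[ps Ps]].
  by rewrite mem_filter => /andP[-> _]; split=> //; apply: valP.
by exists (Partition ps); rewrite ?mem_filter ?mem_index_enum ?andbT.
Qed.

Lemma mod6_odd m :
  [&& m != 0 %[mod 6], m != 2 %[mod 6] & m + 2 != 0 %[mod 6]] = odd m.
Proof. lia. Qed.

Lemma A62_odd_lists n : A 6 2 n = \sum_(s <- odd_lists n n | sumn s == n) 1.
Proof.
rewrite /A -sum1dep_card.
apply: (@sum_partition_of n (all _) (fun=> 1)) => [|s].
  exact: odd_lists_uniq.
rewrite (eq_all mod6_odd) /is_partition.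
case: eqP => [sum_s|_]; rewrite ?andbF // !andbT.
apply/idP/andP => [/odd_listsP[-> odd_s _]|[/andP[sorted_s s0] odd_s]].
  by split=> //; apply/negP => /(allP odd_s).
have le_s y : y \in s -> y <= n by move=> /mem_le_sumn; rewrite sum_s.
apply: mem_odd_lists; rewrite // -?[X in _ <= X]sum_s ?size_le_sumn //.
by apply/allP => y ys; have := le_s _ ys; have := allP odd_s _ ys; lia.
Qed.

Lemma sum_omega3_gap2_upto n :
  \sum_(p : partition_of n | calR p) omega3 p =
  \sum_(s <- gap2_upto (3 * n) | sumn s == n) omega3 s.
Proof.
apply: sum_partition_of => [|s]; first exact: gap2_upto_uniq.
rewrite mem_gap2_upto /is_partition.
case: eqP => [sum_s|_]; rewrite ?andbF // !andbT.
have -> : all (leq^~ (3 * n)) s.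
  by apply/allP => y /mem_le_sumn; rewrite sum_s; lia.
case R: (calR s); rewrite ?andbF //= !andbT.
suff -> : sorted geq s by [].
by apply: sub_sorted (pairwise_sorted R) => a b /=; lia.
Qed.

Theorem theorem3 (n : nat) :
  A 6 2 n = \sum_(p : partition_of n | calR p) omega3 p.
Proof.
by rewrite A62_odd_lists sum_omega3_gap2_upto count_odd_lists_omega3.
Qed.
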